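(* For every integer $n$ with $2\le n\le 60$, there exists a set $S\subseteq G_n=\{0,1,\dots,n-1\}^2$ of lattice points such that every affine line in $\mathbb{R}^2$ contains at most two points of $S$, and every row $\{(i,j): i\in\{0,\dots,n-1\}\}$ (for each fixed $j\in\{0,\dots,n-1\}$) contains exactly two points of $S$ (so $|S|=2n$). In particular, $D(n)=2n$ for all $2\le n\le 60$, where $D(n)$ denotes the maximum cardinality of a subset of $G_n$ with no three points collinear.
   Context: $G_n=\{0,1,\dots,n-1\}^2\subset\mathbb{Z}^2$ is the $n\times n$ grid of lattice points. A set of points has ''no three collinear'' if no affine line in $\mathbb{R}^2$ contains three or more of its points. $D(n)$ is the maximum size of a subset of $G_n$ with no three collinear. *)

(* Defs.v *)
From HB Require Import structures.
From mathcomp Require Import all_boot all_order all_algebra.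
From mathcomp Require Import boolp classical_sets reals.
Set Implicit Arguments.
Unset Strict Implicit.
Unset Printing Implicit Defensive.
Import Order.TTheory GRing.Theory Num.Theory.
Local Open Scope classical_set_scope.
Local Open Scope ring_scope.

Definition grid (n : nat) : finType := ('I_n * 'I_n)%type.

Definition to_plane (R : realType) (n : nat) (q : grid n) : R * R :=
  ((q.1 : nat)%:R, (q.2 : nat)%:R).

Definition affine_line (R : realType) (L : set (R * R)) : Prop :=
  exists p d : R * R,
    d != 0 /\ L = [set (p.1 + t * d.1, p.2 + t * d.2) | t in [set: R]].

Definition points_on (R : realType) (n : nat) (S : {set grid n})
    (L : set (R * R)) : {set grid n} :=
  [set q in S | to_plane R q \in L]%SET.

Definition no_three_collinear (R : realType) (n : nat) (S : {set grid n}) :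
    Prop :=
  forall L : set (R * R), affine_line L -> (#|points_on S L| <= 2)%N.

(* The points (i, j) with j fixed: a row is indexed by its second coordinate. *)
Definition row_points (n : nat) (j : 'I_n) : {set grid n} :=
  [set q : grid n | q.2 == j]%SET.

(* The maximum ranges over a nonempty family, as it contains the empty set. *)
Definition D (R : realType) (n : nat) : nat :=
  (\max_(S : {set grid n} | `[< no_three_collinear R S >]) #|S|)%N.

(* Main.v *)
(* A row is contained in a line, so a set without three collinear points has at
   most two points in each row: this is the upper bound. The lower bound is
   witnessed by explicit configurations with two points in each row. Such a
   configuration has no three collinear points as soon as, for each of its
   points, the slopes dx / dy of the segments to the points of the rows above it
   are distinct; this is decided by computation. *)

Require Import Defs.
From HB Require Import structures.
From Stdlib Require Import NArith.
From mathcomp Require Import all_boot all_order all_algebra.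
From mathcomp Require Import boolp classical_sets reals.
From mathcomp Require Import zify ring.

Set Implicit Arguments.
Unset Strict Implicit.
Unset Printing Implicit Defensive.

Import Order.TTheory GRing.Theory Num.Theory.

(** * A fast test that a list of binary numbers has no repetition *)

HB.instance Definition _ := hasDecEq.Build positive Pos.eqb_spec.

Definition odd_halves := pmap (fun p => if p is xI q then Some q else None).

Definition even_halves := pmap (fun p => if p is xO q then Some q else None).

(* Splitting on the lowest binary digit separates the entries after a
   number of digits that is about the logarithm of the length. *)
Fixpoint distinct (fuel : nat) (s : seq positive) : bool :=
  if s is _ :: _ :: _ then
    if fuel is k.+1 then
      [&& count (fun p => if p is xH then true else false) s <= 1,
          distinct k (odd_halves s) & distinct k (even_halves s)]
    else false
  else true.

(** Two equal entries are both 1, both odd or both even. The first case is excluded by the count,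
    and in the other two their halves would repeat in one of the two shorter lists. Exhausted fuel
    yields [false], so soundness holds for any amount of fuel. *)
Lemma distinct_uniq fuel s : distinct fuel s -> uniq s.
Proof.
elim: fuel s => [|k IHk] [|x [|y s]] //.
move=> /and3P[ones /IHk odds /IHk evens].
(* An inner induction on the list carries the three tests along; the head is odd and above 1, even,
   or equal to 1. In the first two cases a second copy of the head in [u] would put its half among
   the halves of [u]. *)
elim: [:: x, y & s] ones odds evens => //= -[q|q|] u IHu /=.
- move=> ones /andP[qu odds] evens; rewrite IHu // andbT.
  by apply: contra qu => qu; rewrite mem_pmap; apply/mapP; exists (xI q).
- move=> ones odds /andP[qu evens]; rewrite IHu // andbT.
  by apply: contra qu => qu; rewrite mem_pmap; apply/mapP; exists (xO q).
(* A head equal to 1 already uses up the count, so no entry of [u] is 1. *)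
- rewrite add1n ltnS leqNgt -has_count => /hasPn ones odds evens.
  rewrite IHu ?andbT //; first by apply/negP => /ones.
  by rewrite leqNgt; apply/negP => /ltnW; rewrite -has_count => /hasP[p /ones /negP].
Qed.

(** * Slopes encoded as integer keys, and the validity test for a configuration *)

Definition pick_column (second : bool) (r : N * N) : N :=
  if second then r.2 else r.1.

(* Up to the injection [N.succ_pos], the keys are the slopes dx / dy of the
   segments from a point in column [c] to the points of the rows above it,
   shifted by 60 to be positive and multiplied by a common denominator. *)
Fixpoint slope_keys (c off : N) (ws : seq N) (rows : seq (N * N)) :
    seq positive :=
  match rows, ws with
  | r :: rows', w :: ws' =>
      [:: N.succ_pos ((r.1 + off - c) * w)%num, N.succ_pos ((r.2 + off - c) * w)%num
        & slope_keys c (off + 60)%num ws' rows']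
  | _, _ => [::]
  end.

Fixpoint slopes_distinct (fuel : nat) (ws : seq N) (rows : seq (N * N)) : bool :=
  if rows is r :: rows' then
    [&& distinct fuel (slope_keys r.1 60 ws rows'),
        distinct fuel (slope_keys r.2 60 ws rows')
      & slopes_distinct fuel ws rows']
  else true.

(** The weight at index [i] is [l / (i + 1)]: multiplying by it divides by the row difference
    [i + 1], up to the common factor [l], without leaving the integers. *)
Definition inverse_rows (ws : seq N) (l : N) : Prop :=
  forall i, i < size ws -> (nth 0%num ws i * N.of_nat i.+1 = l)%num.

(** The bounds keep every column below 60, so that subtracting a column from a shifted one is never
    truncated; the strict order in each pair makes the two points of a row different. *)
Definition valid (fuel : nat) (ws : seq N) (n : nat) (rows : seq (N * N)) : bool :=
  [&& size rows == n, n <= 60,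
      all (fun r => (r.1 <? r.2)%num && (r.2 <? N.of_nat n)%num) rows
    & slopes_distinct fuel ws rows].

(** The two keys of a row are adjacent, so row [i] occupies the positions [2i] and [2i + 1]. The
    offset grows by 60 per row; started at 60, it is 60 times the row difference [i + 1], which
    shifts the slope itself by exactly 60. *)
Lemma nth_slope_keys c off ws rows i (second : bool) :
  i < size rows <= size ws ->
  nth 1%positive (slope_keys c off ws rows) (i.*2 + second) =
  N.succ_pos ((pick_column second (nth (0, 0)%num rows i)
               + (off + 60 * N.of_nat i) - c) * nth 0%num ws i)%num.
Proof.
elim: rows off ws i => [|r rows IHr] off ws i; first by rewrite ltn0.
case: ws => [|w ws]; first by rewrite andbF.
case: i => [|i] hi; last first.
  by rewrite doubleS !addSn /= IHr //; congr (N.succ_pos (_ * _)%num); lia.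
by case: second {IHr hi}; congr (N.succ_pos (_ * _)%num); rewrite /=; lia.
Qed.

Lemma size_slope_keys c off ws rows :
  size rows <= size ws -> size (slope_keys c off ws rows) = (size rows).*2.
Proof. by elim: rows off ws => [|r rows IHr] off [|w ws] //= /IHr ->. Qed.

Lemma succ_pos_inj : injective N.succ_pos.
Proof.
by move=> a b eq_ab; rewrite -(N.pos_pred_succ a) eq_ab N.pos_pred_succ.
Qed.

(** The excluded equation is [(x - c) / (i + 1) = (y - c) / (j + 1)], cross-multiplied and
    rearranged so that no subtraction occurs. Equal slopes would give equal keys at two different
    positions of a list without repetition. *)
Lemma slope_keys_not_collinear fuel (c : N) ws l rows i j (si sj : bool) :
    inverse_rows ws l -> (c < 60)%num -> (0 < l)%num ->
    distinct fuel (slope_keys c 60 ws rows) -> i < j < size rows ->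
    size rows <= size ws ->
    let x := pick_column si (nth (0, 0)%num rows i) in
    let y := pick_column sj (nth (0, 0)%num rows j) in
  (x * N.of_nat j.+1 + c * N.of_nat i.+1 <> y * N.of_nat i.+1 + c * N.of_nat j.+1)%num.
Proof.
move=> wsP c60 l_gt0 /distinct_uniq keys_uniq /andP[ij jn] sz x y eq_xy.
have keyE k (s : bool) : k < size rows -> (nth 1%positive (slope_keys c 60 ws rows) (k.*2 + s)
    = N.succ_pos ((pick_column s (nth (0, 0)%num rows k) + (60 + 60 * N.of_nat k) - c) * nth 0%num ws k)%num).
  by move=> kn; rewrite nth_slope_keys ?kn.
have ineq : i.*2 + si != j.*2 + sj by case: (si) (sj) => [] []; lia.
case/negP: ineq; rewrite -(nth_uniq 1%positive _ _ keys_uniq) ?size_slope_keys //;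
  try by case: (si) (sj) => [] []; lia.
rewrite !keyE ?(ltn_trans ij) // -/x -/y; apply/eqP; congr N.succ_pos.
have wi := wsP i (leq_trans (ltn_trans ij jn) sz).
have wj := wsP j (leq_trans jn sz).
set a := nth 0%num ws i in wi *; set b := nth 0%num ws j in wj *.
(* Multiplying by both row differences turns each weight into the same factor [l], which then
   cancels. *)
apply: (N.mul_reg_r _ _ (N.of_nat i.+1 * N.of_nat j.+1)%num); first lia.
have -> : ((x + (60 + 60 * N.of_nat i) - c) * a * (N.of_nat i.+1 * N.of_nat j.+1)
  = (x + (60 + 60 * N.of_nat i) - c) * N.of_nat j.+1 * (a * N.of_nat i.+1))%num by lia.
have -> : ((y + (60 + 60 * N.of_nat j) - c) * b * (N.of_nat i.+1 * N.of_nat j.+1)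
  = (y + (60 + 60 * N.of_nat j) - c) * N.of_nat i.+1 * (b * N.of_nat j.+1))%num by lia.
rewrite wi wj; congr (_ * _)%num.
(* Since [c < 60] the subtractions are exact, and both sides contain the same shift
   [60 * (i + 1) * (j + 1)]; what remains is [eq_xy]. *)
nia.
Qed.

(* The quotients of lcm(1, ..., 59) by 1, ..., 59. *)
Definition weights : seq N :=
  [:: 9690712164777231700912800; 4845356082388615850456400;
      3230237388259077233637600; 2422678041194307925228200;
      1938142432955446340182560; 1615118694129538616818800;
      1384387452111033100130400; 1211339020597153962614100;
      1076745796086359077879200; 969071216477723170091280;
      880973833161566518264800; 807559347064769308409400;
      745439397290556284685600; 692193726055516550065200;
      646047477651815446727520; 605669510298576981307050;
      570041892045719511818400; 538372898043179538939600;
      510037482356696405311200; 484535608238861585045640;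
      461462484037011033376800; 440486916580783259132400;
      421335311512053552213600; 403779673532384654204700;
      387628486591089268036512; 372719698645278142342800;
      358915265362119692626400; 346096863027758275032600;
      334162488440594196583200; 323023738825907723363760;
      312603618218620377448800; 302834755149288490653525;
      293657944387188839421600; 285020946022859755909200;
      276877490422206620026080; 269186449021589769469800;
      261911139588573829754400; 255018741178348202655600;
      248479799096852094895200; 242267804119430792522820;
      236358833287249553680800; 230731242018505516688400;
      225365399180865853509600; 220243458290391629566200;
      215349159217271815575840; 210667655756026776106800;
      206185365208026206402400; 201889836766192327102350;
      197769636015861871447200; 193814243295544634018256;
      190013964015239837272800; 186359849322639071171400;
      182843625750513805677600; 179457632681059846313200;
      176194766632313303652960; 173048431513879137516300;
      170012494118898801770400; 167081244220297098291600;
      164249358725037825439200]%num.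

(* For each n from 2 on, the columns of the two points of every row. They come
   from a computer search; for n >= 16 it ran over the configurations invariant
   under a quarter turn (n even), or invariant up to a single antipodal pair of
   points on a diagonal (n odd). *)
Definition configurations : seq (seq (N * N)) := [::
  [:: (0, 1); (0, 1)];
  [:: (0, 1); (0, 2); (1, 2)];
  [:: (0, 1); (2, 3); (0, 1); (2, 3)];
  [:: (0, 1); (0, 3); (3, 4); (1, 2); (2, 4)];
  [:: (0, 1); (3, 5); (1, 4); (0, 2); (4, 5); (2, 3)];
  [:: (0, 2); (1, 2); (5, 6); (1, 4); (0, 6); (3, 4); (3, 5)];
  [:: (0, 2); (3, 5); (0, 3); (6, 7); (5, 7); (1, 2); (4, 6); (1, 4)];
  [:: (0, 3); (4, 6); (3, 6); (1, 7); (0, 2); (1, 7); (5, 8); (4, 8); (2, 5)];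
  [:: (0, 1); (0, 5); (6, 8); (4, 8); (3, 9); (1, 7); (2, 9); (5, 7); (2, 3);
      (4, 6)];
  [:: (0, 1); (4, 6); (3, 5); (8, 9); (0, 2); (3, 7); (8, 10); (1, 2); (5, 7);
      (4, 6); (9, 10)];
  [:: (3, 9); (1, 10); (0, 5); (7, 11); (3, 5); (7, 9); (2, 4); (6, 8); (0,
      4); (6, 11); (1, 10); (2, 8)];
  [:: (1, 6); (5, 8); (8, 12); (1, 10); (0, 3); (2, 7); (3, 9); (5, 10); (9,
      12); (2, 11); (0, 4); (4, 7); (6, 11)];
  [:: (8, 9); (3, 5); (3, 9); (11, 12); (0, 2); (0, 12); (6, 7); (6, 7); (1,
      13); (11, 13); (1, 2); (4, 10); (8, 10); (4, 5)];
  [:: (3, 6); (7, 13); (9, 13); (2, 14); (2, 6); (0, 4); (9, 10); (3, 11); (4,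
      5); (10, 14); (8, 12); (0, 12); (1, 5); (1, 7); (8, 11)];
  [:: (11, 12); (3, 6); (5, 7); (0, 14); (0, 10); (4, 13); (7, 14); (9, 13);
      (2, 6); (1, 8); (2, 11); (5, 15); (1, 15); (8, 10); (9, 12); (3, 4)];
  [:: (10, 13); (1, 7); (5, 7); (0, 12); (3, 5); (12, 14); (0, 8); (14, 15);
      (6, 10); (1, 2); (8, 16); (2, 4); (11, 13); (4, 16); (9, 11); (9, 15);
      (3, 6)];
  [:: (6, 10); (12, 13); (6, 8); (12, 13); (1, 3); (1, 3); (15, 17); (0, 8);
      (10, 15); (2, 7); (9, 17); (0, 2); (14, 16); (14, 16); (4, 5); (9, 11);
      (4, 5); (7, 11)];
  [:: (5, 8); (11, 14); (2, 8); (4, 6); (1, 15); (6, 18); (13, 15); (1, 9);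
      (16, 18); (7, 11); (0, 2); (9, 17); (3, 5); (0, 12); (3, 17); (12, 14);
      (10, 16); (4, 7); (10, 13)];
  [:: (5, 15); (3, 8); (6, 10); (15, 18); (0, 3); (8, 19); (12, 17); (6, 9);
      (14, 18); (2, 12); (7, 17); (1, 5); (10, 13); (2, 7); (0, 11); (16, 19);
      (1, 4); (9, 13); (11, 16); (4, 14)];
  [:: (5, 12); (11, 13); (5, 12); (3, 16); (3, 9); (18, 20); (7, 10); (1, 14);
      (0, 2); (1, 16); (6, 14); (4, 19); (18, 20); (6, 19); (10, 13); (0, 2);
      (11, 17); (4, 17); (8, 15); (7, 9); (8, 15)];
  [:: (13, 15); (8, 9); (15, 17); (7, 9); (2, 16); (4, 7); (0, 2); (16, 18);
      (0, 20); (18, 20); (10, 11); (10, 11); (1, 3); (1, 21); (3, 5); (19,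
      21); (14, 17); (5, 19); (12, 14); (4, 6); (12, 13); (6, 8)];
  [:: (12, 17); (1, 8); (8, 12); (17, 18); (3, 13); (0, 3); (13, 15); (6, 11);
      (20, 21); (4, 6); (0, 2); (7, 15); (20, 22); (16, 18); (1, 2); (11, 16);
      (7, 9); (19, 22); (9, 19); (4, 5); (10, 14); (14, 21); (5, 10)];
  [:: (7, 15); (6, 12); (8, 11); (7, 14); (4, 19); (6, 10); (18, 22); (20,
      23); (0, 21); (3, 13); (9, 18); (1, 21); (2, 22); (5, 14); (10, 20); (2,
      23); (0, 3); (1, 5); (13, 17); (4, 19); (9, 16); (12, 15); (11, 17); (8,
      16)];
  [:: (9, 13); (8, 18); (12, 18); (3, 20); (3, 8); (14, 17); (1, 2); (5, 9);
      (20, 23); (17, 24); (5, 13); (0, 10); (2, 22); (14, 24); (11, 19); (0,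
      7); (1, 4); (15, 19); (22, 23); (7, 10); (16, 21); (4, 21); (6, 12); (6,
      16); (11, 15)];
  [:: (10, 13); (12, 21); (18, 19); (5, 19); (1, 8); (14, 22); (2, 3); (2, 8);
      (18, 21); (10, 11); (16, 25); (5, 16); (0, 24); (1, 25); (9, 20); (0,
      9); (14, 15); (4, 7); (17, 23); (22, 23); (3, 11); (17, 24); (6, 20);
      (6, 7); (4, 13); (12, 15)];
  [:: (6, 8); (6, 9); (15, 19); (3, 4); (8, 23); (14, 15); (25, 26); (2, 17);
      (22, 26); (7, 25); (13, 14); (2, 5); (5, 10); (10, 16); (16, 21); (21,
      24); (12, 13); (1, 19); (0, 4); (9, 24); (0, 1); (11, 12); (3, 18); (22,
      23); (7, 11); (17, 20); (18, 20)];
  [:: (7, 14); (10, 11); (5, 20); (9, 15); (12, 22); (4, 25); (8, 17); (2,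
      27); (14, 21); (11, 24); (6, 26); (18, 26); (3, 23); (0, 8); (19, 27);
      (4, 24); (1, 9); (1, 21); (3, 16); (6, 13); (0, 25); (10, 19); (2, 23);
      (5, 15); (12, 18); (7, 22); (16, 17); (13, 20)];
  [:: (22, 24); (10, 25); (15, 22); (1, 3); (0, 14); (18, 21); (0, 2); (5,
      15); (9, 11); (16, 20); (5, 27); (12, 20); (9, 17); (2, 7); (4, 24);
      (21, 26); (11, 19); (8, 16); (1, 23); (8, 12); (17, 19); (13, 23); (26,
      28); (7, 10); (14, 28); (25, 27); (6, 13); (3, 18); (4, 6)];
  [:: (8, 17); (11, 22); (12, 13); (19, 23); (22, 24); (4, 9); (3, 15); (1,
      4); (20, 29); (8, 24); (3, 15); (16, 28); (0, 27); (11, 27); (6, 10);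
      (19, 23); (2, 18); (2, 29); (1, 13); (14, 26); (5, 21); (0, 9); (25,
      28); (14, 26); (20, 25); (5, 7); (6, 10); (16, 17); (7, 18); (12, 21)];
  [:: (11, 16); (10, 16); (20, 22); (13, 19); (8, 25); (4, 5); (7, 21); (12,
      24); (2, 26); (6, 12); (2, 29); (3, 30); (21, 23); (15, 27); (0, 1);
      (13, 17); (29, 30); (3, 15); (7, 9); (0, 27); (1, 28); (18, 24); (4,
      28); (6, 18); (9, 23); (25, 26); (5, 22); (11, 17); (8, 10); (14, 20);
      (14, 19)];
  [:: (8, 14); (15, 19); (4, 13); (5, 23); (22, 29); (14, 28); (9, 21); (11,
      15); (3, 31); (4, 25); (6, 11); (21, 24); (1, 13); (19, 29); (26, 31);
      (24, 30); (1, 7); (0, 5); (2, 12); (18, 30); (7, 10); (20, 25); (6, 27);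
      (0, 28); (16, 20); (10, 22); (3, 17); (2, 9); (8, 26); (18, 27); (12,
      16); (17, 23)];
  [:: (9, 17); (14, 22); (3, 24); (10, 30); (14, 24); (12, 26); (5, 6); (12,
      21); (2, 4); (17, 32); (1, 29); (7, 19); (25, 27); (11, 16); (28, 31);
      (0, 9); (13, 19); (23, 32); (1, 4); (16, 21); (5, 7); (13, 25); (3, 31);
      (0, 15); (28, 30); (11, 20); (26, 27); (6, 20); (8, 18); (2, 22); (8,
      29); (10, 18); (15, 23)];
  [:: (2, 15); (19, 29); (9, 33); (13, 16); (1, 26); (11, 16); (8, 20); (4,
      11); (24, 27); (8, 31); (14, 15); (26, 28); (12, 21); (6, 30); (1, 23);
      (23, 33); (28, 30); (3, 5); (0, 10); (10, 32); (3, 27); (12, 21); (5,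
      7); (18, 19); (2, 25); (6, 9); (22, 29); (13, 25); (17, 22); (7, 32);
      (17, 20); (0, 24); (4, 14); (18, 31)];
  [:: (13, 22); (9, 24); (18, 27); (20, 21); (11, 26); (5, 15); (8, 9); (2,
      14); (4, 28); (28, 33); (1, 12); (15, 30); (0, 24); (3, 34); (3, 27);
      (23, 29); (2, 17); (16, 18); (17, 32); (5, 11); (7, 31); (0, 31); (10,
      34); (4, 19); (22, 33); (1, 6); (6, 30); (20, 32); (25, 26); (19, 29);
      (8, 23); (13, 14); (7, 16); (10, 25); (12, 21)];
  [:: (11, 15); (16, 21); (5, 12); (22, 25); (7, 8); (21, 33); (8, 12); (26,
      31); (29, 31); (7, 15); (3, 18); (19, 35); (29, 33); (3, 18); (1, 5);
      (26, 35); (11, 34); (10, 13); (22, 25); (1, 24); (0, 9); (30, 34); (17,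
      32); (2, 6); (0, 16); (17, 32); (20, 28); (4, 6); (4, 9); (23, 27); (2,
      14); (27, 28); (10, 13); (23, 30); (14, 19); (20, 24)];
  [:: (10, 15); (9, 17); (13, 33); (2, 16); (4, 12); (7, 24); (15, 26); (17,
      31); (11, 27); (8, 35); (6, 36); (14, 28); (5, 32); (18, 34); (16, 25);
      (30, 36); (22, 33); (29, 35); (13, 23); (1, 7); (3, 14); (0, 6); (11,
      20); (2, 18); (4, 31); (8, 22); (0, 30); (1, 28); (9, 25); (5, 19); (10,
      21); (12, 29); (24, 32); (20, 34); (3, 23); (19, 27); (21, 26)];
  [:: (23, 25); (27, 29); (8, 11); (14, 19); (5, 7); (22, 33); (19, 24); (12,
      33); (1, 35); (20, 22); (1, 13); (16, 35); (0, 30); (6, 27); (0, 34);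
      (5, 9); (17, 26); (9, 21); (3, 6); (31, 34); (16, 28); (11, 20); (28,
      32); (3, 37); (10, 31); (7, 37); (2, 21); (24, 36); (15, 17); (2, 36);
      (4, 25); (13, 18); (4, 15); (30, 32); (18, 23); (26, 29); (8, 10); (12,
      14)];
  [:: (16, 17); (14, 28); (5, 6); (11, 34); (3, 23); (5, 36); (16, 36); (26,
      29); (12, 23); (7, 18); (1, 18); (25, 35); (7, 30); (11, 19); (17, 37);
      (4, 8); (32, 38); (24, 38); (28, 29); (13, 25); (9, 10); (0, 14); (0,
      6); (30, 34); (1, 21); (19, 27); (8, 31); (3, 13); (20, 37); (20, 31);
      (15, 26); (9, 12); (2, 22); (2, 33); (15, 35); (4, 27); (32, 33); (10,
      24); (21, 22)];
  [:: (15, 16); (19, 25); (30, 33); (5, 19); (12, 25); (33, 36); (2, 5); (22,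
      26); (11, 28); (2, 18); (15, 22); (8, 31); (26, 35); (7, 12); (1, 4);
      (29, 39); (21, 39); (7, 10); (16, 30); (36, 38); (1, 3); (9, 23); (29,
      32); (0, 18); (0, 10); (35, 38); (27, 32); (4, 13); (8, 31); (17, 24);
      (21, 37); (11, 28); (13, 17); (34, 37); (3, 6); (14, 27); (20, 34); (6,
      9); (14, 20); (23, 24)];
  [:: (17, 19); (15, 30); (12, 33); (26, 34); (22, 31); (5, 13); (3, 16); (2,
      9); (20, 29); (4, 33); (1, 23); (8, 12); (29, 38); (26, 35); (3, 13);
      (19, 39); (22, 34); (10, 40); (4, 16); (25, 40); (8, 32); (0, 15); (24,
      36); (0, 30); (6, 18); (1, 21); (27, 37); (5, 14); (2, 11); (28, 32);
      (17, 39); (7, 36); (11, 20); (31, 38); (24, 37); (27, 35); (9, 18); (6,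
      14); (7, 28); (10, 25); (21, 23)];
  [:: (20, 22); (9, 17); (9, 29); (18, 31); (28, 35); (14, 17); (4, 8); (11,
      23); (20, 35); (39, 40); (3, 13); (16, 34); (2, 15); (4, 31); (19, 36);
      (25, 29); (15, 30); (36, 40); (7, 38); (0, 27); (33, 41); (0, 8); (14,
      41); (3, 34); (1, 5); (11, 26); (12, 16); (5, 22); (10, 37); (26, 39);
      (7, 25); (28, 38); (1, 2); (6, 21); (18, 30); (33, 37); (24, 27); (6,
      13); (10, 23); (12, 32); (24, 32); (19, 21)];
  [:: (10, 26); (10, 15); (23, 33); (11, 23); (16, 28); (5, 29); (24, 25);
      (30, 34); (7, 12); (2, 20); (41, 42); (25, 39); (7, 34); (5, 20); (4,
      15); (28, 41); (0, 38); (6, 11); (6, 21); (2, 3); (29, 33); (18, 24);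
      (9, 13); (39, 40); (21, 36); (31, 36); (4, 42); (1, 14); (27, 38); (22,
      37); (8, 35); (3, 17); (0, 1); (22, 40); (30, 35); (8, 12); (17, 18);
      (13, 37); (14, 26); (19, 31); (9, 19); (27, 32); (16, 32)];
  [:: (11, 27); (13, 19); (26, 39); (27, 31); (2, 7); (8, 20); (25, 32); (15,
      39); (25, 38); (15, 30); (19, 20); (6, 43); (3, 29); (9, 42); (12, 21);
      (34, 36); (0, 3); (2, 22); (6, 8); (33, 42); (33, 38); (17, 29); (14,
      26); (5, 10); (1, 10); (35, 37); (21, 41); (40, 43); (7, 9); (22, 31);
      (1, 34); (14, 40); (0, 37); (23, 24); (13, 28); (5, 18); (4, 28); (11,
      18); (23, 35); (36, 41); (12, 16); (4, 17); (24, 30); (16, 32)];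
  [:: (23, 28); (29, 31); (22, 26); (8, 10); (15, 17); (14, 38); (5, 21); (10,
      33); (32, 41); (9, 17); (37, 41); (7, 19); (8, 30); (1, 16); (12, 39);
      (1, 40); (0, 31); (35, 40); (2, 24); (24, 33); (18, 19); (0, 38); (2,
      42); (6, 44); (25, 26); (11, 20); (20, 42); (4, 9); (13, 44); (4, 43);
      (5, 32); (28, 43); (14, 36); (25, 37); (3, 7); (27, 35); (3, 12); (11,
      34); (23, 39); (6, 30); (27, 29); (34, 36); (18, 22); (13, 15); (16,
      21)];
  [:: (8, 16); (14, 28); (23, 25); (7, 14); (6, 18); (19, 30); (33, 41); (33,
      42); (36, 45); (8, 21); (13, 18); (23, 29); (6, 7); (15, 35); (42, 44);
      (5, 32); (11, 45); (1, 21); (35, 41); (25, 40); (2, 19); (28, 36); (2,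
      11); (34, 43); (9, 17); (26, 43); (5, 20); (4, 10); (24, 44); (0, 34);
      (13, 40); (1, 3); (10, 30); (38, 39); (16, 22); (27, 32); (24, 37); (0,
      9); (3, 12); (4, 12); (15, 26); (27, 39); (31, 38); (20, 22); (17, 31);
      (29, 37)];
  [:: (16, 21); (15, 38); (3, 10); (40, 44); (24, 33); (20, 34); (3, 14); (7,
      35); (1, 21); (27, 31); (22, 44); (7, 20); (5, 14); (4, 17); (34, 40);
      (9, 45); (19, 46); (28, 33); (17, 23); (9, 30); (35, 41); (38, 46); (4,
      36); (18, 28); (10, 42); (0, 8); (5, 11); (16, 37); (23, 29); (13, 18);
      (0, 27); (1, 37); (6, 12); (29, 42); (32, 41); (26, 39); (2, 24); (15,
      19); (25, 45); (11, 39); (32, 43); (12, 26); (13, 22); (2, 6); (36, 43);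
      (8, 31); (25, 30)];
  [:: (15, 25); (25, 27); (14, 34); (34, 38); (16, 28); (21, 39); (33, 36);
      (17, 26); (5, 9); (3, 39); (23, 35); (6, 29); (10, 15); (2, 3); (6, 45);
      (35, 47); (29, 43); (24, 40); (11, 16); (4, 27); (1, 19); (7, 42); (0,
      1); (17, 37); (10, 30); (46, 47); (5, 40); (28, 46); (20, 43); (31, 36);
      (7, 23); (4, 18); (0, 12); (2, 41); (44, 45); (32, 37); (18, 41); (12,
      24); (8, 44); (38, 42); (21, 30); (11, 14); (8, 26); (19, 31); (9, 13);
      (13, 33); (20, 22); (22, 32)];
  [:: (18, 39); (11, 23); (26, 33); (6, 19); (25, 33); (14, 30); (7, 45); (21,
      42); (13, 29); (0, 9); (32, 36); (14, 47); (10, 13); (36, 40); (37, 43);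
      (2, 4); (10, 20); (21, 24); (5, 48); (8, 45); (26, 32); (31, 41); (2,
      20); (4, 47); (17, 31); (1, 44); (28, 46); (7, 17); (16, 22); (3, 40);
      (0, 43); (24, 27); (28, 38); (44, 46); (5, 11); (8, 12); (35, 38); (1,
      34); (12, 16); (39, 48); (19, 35); (6, 27); (3, 41); (18, 34); (15, 23);
      (29, 42); (15, 22); (25, 37); (9, 30)];
  [:: (25, 26); (14, 19); (11, 33); (32, 39); (6, 15); (11, 37); (41, 45);
      (27, 33); (6, 20); (12, 32); (3, 14); (44, 47); (5, 40); (23, 28); (39,
      48); (18, 45); (2, 7); (3, 9); (19, 34); (31, 48); (25, 41); (13, 22);
      (7, 28); (0, 36); (0, 20); (29, 49); (13, 49); (21, 42); (27, 36); (8,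
      24); (1, 18); (15, 30); (40, 46); (42, 47); (4, 31); (1, 10); (21, 26);
      (9, 44); (2, 5); (35, 46); (17, 37); (29, 43); (16, 22); (4, 8); (12,
      38); (34, 43); (10, 17); (16, 38); (30, 35); (23, 24)];
  [:: (22, 33); (22, 24); (36, 46); (17, 18); (2, 43); (13, 25); (8, 15); (4,
      38); (30, 44); (18, 34); (10, 37); (21, 29); (7, 23); (10, 45); (2, 20);
      (34, 44); (9, 15); (0, 47); (41, 47); (23, 26); (8, 36); (11, 39); (49,
      50); (31, 38); (19, 49); (5, 45); (1, 31); (12, 19); (0, 1); (11, 39);
      (14, 42); (24, 27); (3, 9); (3, 50); (35, 41); (6, 16); (30, 48); (5,
      40); (27, 43); (21, 29); (13, 40); (16, 32); (6, 20); (12, 46); (35,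
      42); (25, 37); (7, 48); (32, 33); (4, 14); (26, 28); (17, 28)];
  [:: (12, 19); (26, 34); (21, 22); (25, 35); (33, 34); (12, 15); (11, 24);
      (13, 43); (7, 41); (24, 32); (8, 14); (37, 45); (46, 51); (21, 44); (11,
      41); (20, 46); (3, 33); (1, 4); (4, 16); (9, 51); (28, 36); (38, 49);
      (28, 49); (20, 22); (42, 45); (1, 48); (3, 50); (6, 9); (29, 31); (2,
      23); (2, 13); (15, 23); (0, 42); (35, 47); (47, 50); (18, 48); (5, 31);
      (10, 40); (7, 30); (0, 5); (6, 14); (37, 43); (19, 27); (10, 44); (8,
      38); (27, 40); (36, 39); (17, 18); (16, 26); (29, 30); (17, 25); (32,
      39)];
  [:: (4, 24); (23, 30); (17, 33); (30, 41); (9, 52); (17, 20); (12, 26); (36,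
      37); (25, 34); (9, 48); (31, 41); (3, 10); (14, 46); (23, 36); (27, 40);
      (7, 33); (7, 13); (47, 50); (8, 32); (2, 15); (18, 47); (10, 28); (1,
      3); (39, 51); (21, 52); (14, 44); (6, 46); (8, 38); (0, 31); (1, 13);
      (49, 51); (24, 42); (5, 34); (37, 50); (20, 44); (2, 5); (39, 45); (19,
      45); (12, 25); (16, 29); (6, 38); (42, 49); (11, 21); (4, 43); (18, 27);
      (15, 16); (26, 40); (32, 35); (0, 43); (11, 22); (19, 35); (22, 29);
      (28, 48)];
  [:: (11, 19); (19, 28); (32, 49); (15, 43); (2, 25); (15, 20); (24, 37);
      (21, 45); (7, 37); (39, 41); (3, 27); (26, 53); (9, 14); (17, 20); (9,
      41); (48, 50); (6, 8); (30, 40); (29, 31); (52, 53); (40, 48); (2, 46);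
      (18, 23); (17, 31); (18, 47); (1, 49); (10, 42); (11, 43); (4, 52); (6,
      35); (22, 36); (30, 35); (7, 51); (5, 13); (0, 1); (22, 24); (13, 23);
      (45, 47); (3, 5); (12, 44); (33, 36); (39, 44); (0, 27); (26, 50); (12,
      14); (16, 46); (8, 32); (16, 29); (33, 38); (28, 51); (10, 38); (4, 21);
      (25, 34); (34, 42)];
  [:: (20, 32); (18, 27); (20, 33); (40, 42); (10, 31); (42, 44); (18, 33);
      (7, 45); (16, 24); (7, 22); (5, 50); (28, 40); (3, 5); (17, 29); (3,
      11); (16, 19); (39, 46); (28, 41); (48, 53); (29, 39); (52, 54); (2, 6);
      (0, 45); (4, 30); (23, 46); (13, 19); (11, 17); (1, 53); (37, 43); (35,
      41); (8, 31); (24, 50); (9, 54); (48, 52); (0, 2); (15, 25); (1, 6);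
      (13, 26); (8, 15); (35, 38); (43, 51); (25, 37); (49, 51); (14, 26); (4,
      49); (32, 47); (30, 38); (9, 47); (21, 36); (10, 12); (23, 44); (12,
      14); (21, 34); (27, 36); (22, 34)];
  [:: (16, 24); (34, 43); (27, 39); (7, 42); (23, 36); (28, 29); (9, 14); (42,
      52); (20, 25); (14, 49); (25, 44); (10, 15); (1, 20); (3, 7); (46, 49);
      (33, 44); (2, 55); (19, 29); (24, 34); (4, 38); (43, 47); (1, 18); (15,
      23); (33, 51); (37, 55); (45, 47); (5, 17); (5, 53); (2, 50); (38, 50);
      (8, 10); (0, 18); (4, 22); (32, 40); (37, 54); (8, 12); (17, 51); (21,
      31); (26, 36); (0, 53); (11, 22); (6, 9); (48, 52); (35, 54); (40, 45);
      (11, 30); (6, 41); (30, 35); (3, 13); (41, 46); (26, 27); (19, 32); (13,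
      48); (16, 28); (12, 21); (31, 39)];
  [:: (10, 29); (19, 36); (18, 26); (36, 40); (8, 10); (25, 42); (15, 21); (7,
      47); (25, 52); (7, 13); (52, 56); (22, 29); (19, 39); (33, 47); (5, 39);
      (22, 50); (3, 28); (12, 14); (33, 54); (44, 55); (1, 3); (32, 50); (41,
      45); (13, 18); (21, 26); (48, 51); (32, 54); (0, 11); (16, 40); (45,
      56); (2, 24); (5, 8); (30, 35); (38, 43); (11, 15); (6, 24); (53, 55);
      (1, 12); (2, 23); (42, 44); (28, 53); (6, 34); (17, 51); (9, 23); (17,
      37); (27, 34); (0, 4); (43, 49); (4, 31); (9, 49); (35, 41); (14, 31);
      (46, 48); (16, 20); (30, 38); (20, 37); (27, 46)];
  [:: (22, 34); (21, 26); (12, 29); (14, 36); (40, 48); (33, 39); (12, 44);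
      (10, 11); (22, 34); (4, 17); (26, 50); (42, 50); (51, 55); (6, 33); (19,
      54); (11, 25); (32, 39); (4, 48); (5, 16); (37, 43); (19, 29); (3, 56);
      (49, 57); (0, 8); (5, 13); (16, 42); (47, 56); (27, 30); (2, 20); (37,
      55); (27, 30); (1, 10); (15, 41); (44, 52); (49, 57); (0, 8); (1, 54);
      (28, 38); (14, 20); (41, 52); (9, 53); (18, 25); (32, 46); (3, 38); (24,
      51); (2, 6); (7, 15); (7, 31); (40, 53); (23, 35); (46, 47); (13, 45);
      (18, 24); (9, 17); (21, 43); (28, 45); (31, 36); (23, 35)];
  [:: (19, 40); (14, 41); (32, 36); (46, 47); (16, 21); (28, 52); (5, 32);
      (13, 17); (27, 39); (31, 48); (9, 42); (3, 11); (3, 20); (35, 51); (35,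
      57); (22, 30); (10, 54); (1, 51); (0, 33); (8, 58); (34, 46); (33, 54);
      (2, 43); (13, 14); (20, 29); (18, 21); (2, 6); (9, 50); (15, 53); (24,
      34); (5, 43); (8, 49); (52, 56); (37, 40); (29, 38); (44, 45); (15, 56);
      (4, 25); (12, 24); (0, 50); (25, 58); (7, 57); (4, 48); (28, 36); (1,
      23); (7, 23); (38, 55); (47, 55); (16, 49); (10, 27); (19, 31); (41,
      45); (26, 53); (6, 30); (37, 42); (11, 12); (22, 26); (17, 44); (18,
      39)];
  [:: (36, 43); (25, 32); (37, 50); (18, 21); (26, 30); (9, 51); (14, 44);
      (18, 46); (5, 26); (2, 54); (29, 37); (25, 42); (14, 39); (7, 32); (47,
      53); (6, 43); (0, 15); (11, 39); (52, 56); (24, 28); (12, 17); (23, 56);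
      (2, 10); (0, 38); (28, 40); (48, 58); (51, 55); (1, 13); (35, 40); (4,
      49); (10, 55); (19, 24); (46, 58); (4, 8); (1, 11); (19, 31); (21, 59);
      (49, 57); (3, 36); (42, 47); (31, 35); (3, 7); (20, 48); (44, 59); (16,
      53); (6, 12); (27, 52); (20, 45); (17, 34); (22, 30); (5, 57); (33, 54);
      (13, 41); (15, 45); (8, 50); (29, 33); (38, 41); (9, 22); (27, 34); (16,
      23)]]%num.

(** * From a table of columns to a point set without three collinear points *)

Lemma slopes_distinct_nth fuel ws rows k (s : bool) :
  slopes_distinct fuel ws rows -> k < size rows ->
  distinct fuel
    (slope_keys (pick_column s (nth (0, 0)%num rows k)) 60 ws (drop k.+1 rows)).
Proof.
elim: rows k => // r rows IHr [|k] /and3P[r1 r2 rs] kn; last exact: IHr.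
by rewrite drop1 /=; case: s {IHr}.
Qed.

Definition column (rows : seq (N * N)) (s : bool) (k : nat) : nat :=
  N.to_nat (pick_column s (nth (0, 0)%num rows k)).

Definition point_set (n : nat) (rows : seq (N * N)) : {set grid n} :=
  [set q : grid n | ((q.1 : nat) == column rows false q.2)
                 || ((q.1 : nat) == column rows true q.2)]%SET.

Lemma in_point_set n rows (q : grid n) :
  q \in point_set n rows -> exists s, (q.1 : nat) = column rows s q.2.
Proof. by rewrite inE => /orP[] /eqP; [exists false | exists true]. Qed.

(** With the six products of the collinearity determinant for [a], ..., [f], the five conclusions
    are the same equation for the other five orders of the three points, each in the exact shape it
    takes after renaming. *)
Lemma cyclic_sums (a b c d e f : nat) :
    a + b + c = d + e + f ->
  [/\ d + e + f = a + b + c, c + a + b = e + f + d, f + d + e = b + c + a,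
      b + c + a = f + d + e & e + f + d = c + a + b].
Proof. by move=> abc; split; lia. Qed.

Section Valid.

Variables (fuel : nat) (ws : seq N) (l : N) (n : nat) (rows : seq (N * N)).
Hypotheses (wsP : inverse_rows ws l) (l_gt0 : (0 < l)%num).
Hypotheses (ws_size : 59 <= size ws) (rowsP : valid fuel ws n rows).

Lemma column_lt k : k < n -> column rows false k < column rows true k < n.
Proof.
case/and4P: rowsP => /eqP sz _ /all_nthP cols _ kn.
have := cols (0, 0)%num k; rewrite sz => /(_ kn) /andP[].
by rewrite /column /pick_column => /N.ltb_lt ? /N.ltb_lt ?; clear l_gt0 ws_size; lia.
Qed.

(** The equation is the vanishing of the determinant of the three points, with its negative terms
    moved across. It amounts to equality of the slopes from the lowest point to the two others,
    which the keys of that point rule out. *)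
Lemma rising_not_collinear y1 y2 y3 s1 s2 s3 :
    y1 < y2 < y3 -> y3 < n ->
    let x1 := column rows s1 y1 in
    let x2 := column rows s2 y2 in
    let x3 := column rows s3 y3 in
  x2 * y3 + x3 * y1 + x1 * y2 <> x3 * y2 + x2 * y1 + x1 * y3.
Proof.
move=> /andP[y12 y23] y3n /=.
case/and4P: rowsP => /eqP sz n60 _ slopes.
have y1n : y1 < n by lia.
have c60 : (pick_column s1 (nth (0, 0)%num rows y1) < 60)%num.
  have := column_lt y1n; rewrite /column; case: s1 => /=; lia.
have ds : distinct fuel (slope_keys (pick_column s1 (nth (0, 0)%num rows y1)) 60
    ws (drop y1.+1 rows)) by apply: slopes_distinct_nth; rewrite ?sz.
have := @slope_keys_not_collinear _ _ _ l _ (y2 - y1.+1) (y3 - y1.+1) s2 s3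
  wsP c60 l_gt0 ds.
have k2 : y1.+1 + (y2 - y1.+1) = y2 by lia.
have k3 : y1.+1 + (y3 - y1.+1) = y3 by lia.
rewrite size_drop sz !nth_drop k2 k3 => neq eq.
have ij : y2 - y1.+1 < y3 - y1.+1 < n - y1.+1 by lia.
(* The side goal asks for a weight for each row above [y1]: there are at most 59 of them, as
   [n <= 60]. *)
apply: (neq ij); first lia.
move: eq; rewrite /column; set x1 := pick_column _ _; set x2 := pick_column _ _.
set x3 := pick_column _ _ => eq.
(* Index 0 of the dropped table is the row just above [y1], so an index plus one is the row
   difference. *)
have e2 : N.of_nat (y2 - y1.+1).+1 = (N.of_nat y2 - N.of_nat y1)%num by lia.
have e3 : N.of_nat (y3 - y1.+1).+1 = (N.of_nat y3 - N.of_nat y1)%num by lia.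
rewrite e2 e3; nia.
Qed.

(** Strictly increasing rows are covered by the slopes. When two consecutive rows coincide, the
    determinant factors as a difference of columns times a difference of rows, so one of them
    vanishes. *)
Lemma sorted_not_collinear (q1 q2 q3 : grid n) :
    q1 \in point_set n rows -> q2 \in point_set n rows ->
    q3 \in point_set n rows -> q1 != q2 -> q2 != q3 -> q3 != q1 ->
    q1.2 <= q2.2 <= q3.2 ->
  q2.1 * q3.2 + q3.1 * q1.2 + q1.1 * q2.2 <>
  q3.1 * q2.2 + q2.1 * q1.2 + q1.1 * q3.2.
Proof.
case: q1 q2 q3 => [x1 y1] [x2 y2] [x3 y3].
move=> /in_point_set /= [s1 e1] /in_point_set /= [s2 e2] /in_point_set /= [s3 e3].
rewrite !xpair_eqE -!val_eqE /= => n12 n23 n31 /andP[y12 y23] eq.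
have [y12'|] := ltnP y1 y2; last first.
  move=> y21; have e12 : y1 = y2 :> nat by lia.
  have x12 : x1 <> x2 :> nat by move: n12; rewrite e12 eqxx andbT => /eqP.
  (* The columns [x1] and [x2] differ, so the third point is in the same row; three distinct points
     would then share two columns. *)
  have e13 : y3 = y1 :> nat by move: eq; rewrite e12; nia.
  move: e1 e2 e3 n23 n31; rewrite e12 e13 e12 eqxx !andbT => e1 e2 e3.
  move: x12; rewrite e1 e2 e3; case: (s1) (s2) (s3) => [] [] [] //; lia.
have [y23'|] := ltnP y2 y3; last first.
  move=> y32; have e23 : y2 = y3 :> nat by lia.
  have x23 : x2 <> x3 :> nat by move: n23; rewrite e23 eqxx andbT => /eqP.
  (* Here [y1 < y2], so the other factor vanishes and the last two points coincide. *)
  by case: x23; move: eq; rewrite e23; nia.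
have := @rising_not_collinear y1 y2 y3 s1 s2 s3; rewrite y12' y23' => /(_ isT (ltn_ord _)).
by rewrite -e1 -e2 -e3.
Qed.

(** Permuting the points preserves the determinant equation up to exchanging its sides, so the
    points may be sorted by row. *)
Lemma point_set_not_collinear (q1 q2 q3 : grid n) :
    q1 \in point_set n rows -> q2 \in point_set n rows ->
    q3 \in point_set n rows -> q1 != q2 -> q2 != q3 -> q3 != q1 ->
  q2.1 * q3.2 + q3.1 * q1.2 + q1.1 * q2.2 <>
  q3.1 * q2.2 + q2.1 * q1.2 + q1.1 * q3.2.
Proof.
move=> i1 i2 i3 n12 n23 n31 eq.
have sorted p1 p2 p3 := @sorted_not_collinear p1 p2 p3.
have n21 := n12; have n32 := n23; have n13 := n31.
rewrite eq_sym in n21; rewrite eq_sym in n32; rewrite eq_sym in n13.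
have [] := cyclic_sums eq.
move=> e132 e312 e213 e231 e321.
(* Of the eight outcomes, those where the first two comparisons agree are already sorted; the third
   comparison settles the others. *)
have [le12|/ltnW le21] := leqP q1.2 q2.2; have [le23|/ltnW le32] := leqP q2.2 q3.2;
  have [le13|/ltnW le31] := leqP q1.2 q3.2.
- by apply: (sorted q1 q2 q3); rewrite ?le12.
- by apply: (sorted q1 q2 q3); rewrite ?le12.
- by apply: (sorted q1 q3 q2); rewrite ?le13.
- by apply: (sorted q3 q1 q2); rewrite ?le31.
- by apply: (sorted q2 q1 q3); rewrite ?le21.
- by apply: (sorted q2 q3 q1); rewrite ?le23.
- by apply: (sorted q3 q2 q1); rewrite ?le32.
- by apply: (sorted q3 q2 q1); rewrite ?le32.
Qed.

Lemma point_set_no_three_collinear (R : realType) :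
  no_three_collinear R (point_set n rows).
Proof.
move=> L [[p1 p2] [[d1 d2] [_ ->]]]; rewrite leqNgt; apply/negP => /card_gt2P.
move=> [q1 [q2 [q3 [[]]]]]; rewrite !inE => /andP[i1 +] /andP[i2 +] /andP[i3 +].
move=> /set_mem /= [t1 _ e1] /set_mem /= [t2 _ e2] /set_mem /= [t3 _ e3].
move=> [n12 n23 n31].
have := @point_set_not_collinear q1 q2 q3.
rewrite !inE => /(_ i1 i2 i3 n12 n23 n31); apply; apply/eqP.
(* The naturals embed injectively into [R], so the equation may be checked there. The coordinates
   are affine in [t1], [t2], [t3] along the line, and the equation becomes a polynomial identity. *)
rewrite -(@eqr_nat R) !natrD !natrM.
case: e1 e2 e3 => <- <- [<- <-] [<- <-]; apply/eqP; ring.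
Qed.

Lemma point_set_row (j : 'I_n) : #|point_set n rows :&: row_points j| = 2.
Proof.
have := column_lt (ltn_ord j) => /andP[c12 c2n].
pose q1 : grid n := (Ordinal (ltn_trans c12 c2n), j).
pose q2 : grid n := (Ordinal c2n, j).
have -> : point_set n rows :&: row_points j = [set q1; q2].
  apply/setP => -[x y]; rewrite !inE !xpair_eqE -!val_eqE /=.
  have [->|] := eqVneq (y : nat) j; by rewrite ?andbT ?andbF.
by rewrite cards2 xpair_eqE -val_eqE /= eqxx andbT neq_ltn c12.
Qed.

End Valid.

(** * Counting points row by row *)

Lemma card_rows n (S : {set grid n}) :
  #|S| = \sum_(j < n) #|S :&: row_points j|.
Proof.
rewrite -sum1_card (partition_big (fun q : grid n => q.2) xpredT) //=.
apply: eq_bigr => j _; rewrite -sum1_card; apply: eq_bigl => q.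
by rewrite !inE.
Qed.

Lemma no_three_collinear_row (R : realType) n (S : {set grid n}) (j : 'I_n) :
  no_three_collinear R S -> #|S :&: row_points j| <= 2.
Proof.
(* The horizontal line at height [j], based at [(0, j)] with direction [(1, 0)]: a point of the row
   lies at the parameter equal to its column. *)
move=> /(_ [set ((0 : R) + t * 1, (j : nat)%:R + t * 0) | t in setT]%R%classic).
move=> h; apply: leq_trans (h _); last first.
  exists (0, j%:R)%R, (1, 0)%R; split => //.
  by apply/negP; rewrite xpair_eqE oner_eq0.
apply: subset_leq_card; apply/fintype.subsetP => q; rewrite !inE => /andP[-> /eqP qj] /=.
apply/mem_set; exists (q.1 : nat)%:R%R => //.
by rewrite /to_plane qj mulr0 addr0 mulr1 add0r.
Qed.

(** * Verification of the tables by computation *)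

Lemma weights_inverse : inverse_rows weights (nth 0%num weights 0).
Proof.
(* The common value [l] is the first weight, the least common multiple divided by 1. *)
have /allP wP : all (fun i => nth 0 weights i * N.of_nat i.+1
    =? nth 0 weights 0)%num (iota 0 (size weights)) by vm_compute.
by move=> i iw; apply/N.eqb_eq/wP; rewrite mem_iota.
Qed.

Lemma configurations_valid n :
  2 <= n <= 60 -> valid 100 weights n (nth [::] configurations (n - 2)).
Proof.
(* The table starts at [n = 2], hence the index [n - 2], and [iota 2 59] runs from 2 to 60. All keys
   are below [2 ^ 90], so a fuel of 100 exceeds their number of binary digits. *)
have /allP vP : all (fun n => valid 100 weights n (nth [::] configurations (n - 2)))
    (iota 2 59) by vm_compute.
by move=> n_range; apply: vP; rewrite mem_iota; lia.
Qed.

Theorem mainTheorem1 (R : realType) (n : nat) (hn : 2 <= n <= 60) :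
  (exists S : {set grid n},
     [/\ no_three_collinear R S,
         forall j : 'I_n, #|S :&: row_points j| = 2
       & #|S| = 2 * n])
  /\ D R n = 2 * n.
Proof.
have validP := configurations_valid hn.
set rows := nth _ _ _ in validP.
have S_free : no_three_collinear R (point_set n rows).
  by apply: (point_set_no_three_collinear weights_inverse _ _ validP).
have S_rows := point_set_row validP.
have S_card : #|point_set n rows| = 2 * n.
  rewrite card_rows (eq_bigr (fun=> 2)) => [|j _]; last exact: S_rows.
  by rewrite sum_nat_const card_ord mulnC.
split; first by exists (point_set n rows).
apply/eqP; rewrite eqn_leq; apply/andP; split.
  (* Upper bound: each of the [n] rows contributes at most 2 to the cardinality. *)
  apply/bigmax_leqP => S /asboolP S_max; rewrite card_rows.
  rewrite -[n in 2 * n]card_ord mulnC -sum_nat_const.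
  by apply: leq_sum => j _; apply: no_three_collinear_row S_max.
rewrite -S_card /D.
by apply: (@leq_bigmax_cond _ _ (fun S : {set grid n} => #|S|)); apply/asboolP.
Qed.
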